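(* Let $d\ge 5$ be odd and $D\ge 4$. If $n=d\left(1+(d-1)+\dots+(d-1)^{D-1}\right)-1\not\equiv 0 \pmod D$, then there is no $(d,D,-2)$-graph (of order $n$).
   Context: All graphs are simple. For integers $\Delta\ge 2$, $D\ge 1$, the Moore bound is $M(\Delta,D)=1+\Delta\left(1+(\Delta-1)+\dots+(\Delta-1)^{D-1}\right)$. For $\epsilon\ge 0$, a $(\Delta,D,-\epsilon)$-graph is a graph of maximum degree $\Delta$, diameter $D$, and order exactly $M(\Delta,D)-\epsilon$. Note that $M(d,D)-2=d\left(1+(d-1)+\dots+(d-1)^{D-1}\right)-1$. *)

(* Defs.v *)
From mathcomp Require Import all_boot.

Set Implicit Arguments.
Unset Strict Implicit.
Unset Printing Implicit Defensive.

Record sgraph := SGraph {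
  vertex :> finType;
  adj : rel vertex;
  adj_sym : symmetric adj;
  adj_irrefl : irreflexive adj
}.

Definition degree (G : sgraph) (x : G) : nat := #|[set y | adj x y]|.

Definition max_degree (G : sgraph) : nat := \max_(x : G) degree x.

(* The walk visits x and then the vertices of p, so it has [size p] edges. *)
Definition walk_of_length (G : sgraph) (x y : G) (k : nat) : Prop :=
  exists p : seq G, [/\ path (@adj G) x p, last x p = y & size p = k].

Definition distance_is (G : sgraph) (x y : G) (k : nat) : Prop :=
  walk_of_length x y k /\ forall j : nat, walk_of_length x y j -> k <= j.

(* Disconnected graphs have no diameter: every pair of vertices is required
   to have a finite distance. *)
Definition diameter_is (G : sgraph) (D : nat) : Prop :=
  (forall x y : G, exists2 k, distance_is x y k & k <= D) /\
  (exists x y : G, distance_is x y D).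

Definition moore_bound (Delta D : nat) : nat :=
  1 + Delta * \sum_(0 <= i < D) (Delta - 1) ^ i.

(* The (Delta, D, -eps)-graphs.  The order condition is written additively so
   that it does not involve truncated subtraction. *)
Definition defect_graph (Delta D eps : nat) (G : sgraph) : Prop :=
  [/\ max_degree G = Delta, diameter_is G D
    & #|G| + eps = moore_bound Delta D].

(* Main.v *)
(* Counting spheres shows that a (d, D, -2)-graph is d-regular and looks like a
   tree up to distance D - 1.  Hence the sum of its distance polynomials in the
   adjacency matrix A is J + B, where B, the defect matrix, is symmetric,
   commutes with A and has row sums 2; call y a repeat of x if B x y > 0.  Every
   vertex has two repeats, its antipodes on the short cycles through it.

   A (2D-1)-cycle, or two vertices joined by three geodesics of length D, is
   ruled out by one argument.  Take a vertex g hanging off this configuration at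
   q, with repeats h and k; let w be the other repeat of h.  As B commutes with
   A, the vertices h, k, w hang off the configuration at the corresponding
   repeats of q and are thus pairwise too close: following the repeats of a
   vertex on the short cycle through g and h produces a short cycle which leaves
   the configuration, although all short cycles through its vertices stay in it.

   So every vertex lies on exactly two short cycles, all of length 2D, and
   counting incidences gives that D divides n. *)

Require Import Defs.
From mathcomp Require Import all_boot zify.

Set Implicit Arguments.
Unset Strict Implicit.
Unset Printing Implicit Defensive.

(** * Distances in a graph of finite diameter *)

Section Distance.

Variables (G : sgraph) (D : nat).
Hypothesis diam : forall x y : G, exists2 k, distance_is x y k & k <= D.

(** Tuples of fixed length form a finite type, so the existence of a walk is decidable and [dist]
    can be taken by [ex_minn]. *)
Definition walkb (x y : G) k :=
  [exists t : k.-tuple G, path (@adj G) x t && (last x t == y)].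

Lemma walkP x y k : reflect (walk_of_length x y k) (walkb x y k).
Proof.
apply: (iffP existsP) => [[t /andP[pt /eqP lt]]|[p [pp lp sp]]].
  by exists t; rewrite size_tuple.
by exists (tcast sp (in_tuple p)); rewrite val_tcast pp lp eqxx.
Qed.

Lemma walk_ex x y : exists k, walkb x y k.
Proof. by have [k [/walkP w _] _] := diam x y; exists k. Qed.

Definition dist x y := ex_minn (walk_ex x y).

Lemma dist_walk x y : walk_of_length x y (dist x y).
Proof. by rewrite /dist; case: ex_minnP => k /walkP. Qed.

Lemma dist_min x y k : walk_of_length x y k -> dist x y <= k.
Proof. by move=> /walkP w; rewrite /dist; case: ex_minnP => j _; apply. Qed.

Lemma dist_le_diam x y : dist x y <= D.
Proof. by have [k [w _] /(leq_trans (dist_min w))] := diam x y. Qed.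

Lemma distxx x : dist x x = 0.
Proof. by apply/eqP; rewrite -leqn0; apply: dist_min; exists [::]. Qed.

Lemma dist0 x y : dist x y = 0 -> x = y.
Proof. by move=> e; have [[|a p] [_ //= lp]] := dist_walk x y; rewrite e. Qed.

Lemma dist_sym x y : dist x y = dist y x.
Proof.
suff H u v : dist u v <= dist v u by apply/eqP; rewrite eqn_leq !H.
have [p [pp lp sp]] := dist_walk v u; rewrite -sp; apply: dist_min.
exists (rev (belast v p)); split; last by rewrite size_rev size_belast.
  rewrite -lp rev_path; apply: sub_path pp => a b.
  by rewrite /= adj_sym.
by case: p pp lp sp => [|a p] //= _ <- _; rewrite rev_cons last_rcons.
Qed.

Lemma dist_triangle y x z : dist x z <= dist x y + dist y z.
Proof.
have [p [pp lp <-]] := dist_walk x y; have [q [pq lq <-]] := dist_walk y z.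
apply: dist_min; exists (p ++ q).
by rewrite cat_path last_cat lp pp pq lq size_cat.
Qed.

Lemma adj_neq (x y : G) : adj x y -> x != y.
Proof. by apply: contraTneq => ->; rewrite adj_irrefl. Qed.

Lemma dist_adj x y : adj x y -> dist x y = 1.
Proof.
move=> a; apply/eqP; rewrite eqn_leq dist_min /=; last first.
  by exists [:: y]; rewrite /= a.
by rewrite lt0n; apply: contraNneq (adj_neq a) => /dist0 ->.
Qed.

Lemma dist1 x y : dist x y = 1 -> adj x y.
Proof.
move=> e; have [[|a [|b p]] [/= pp lp]] := dist_walk x y; rewrite e // => _.
by move: pp; rewrite andbT lp.
Qed.

Lemma dist_step x y z : adj y z -> dist x z <= (dist x y).+1.
Proof. by move=> /dist_adj a; rewrite -addn1 -a dist_triangle. Qed.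

Lemma dist_split x y i j : dist x y = i + j ->
  exists2 z, dist x z = i & dist z y = j.
Proof.
move=> e; have [p [pp lp sp]] := dist_walk x y.
rewrite -(cat_take_drop i p) cat_path last_cat in pp lp.
case/andP: pp => p1 p2; set z := last x _ in p2 lp.
have sz : i <= size p by rewrite sp e leq_addr.
have h1 : dist x z <= i.
  by apply: dist_min; exists (take i p); rewrite size_takel.
have h2 : dist z y <= j.
  apply: dist_min; exists (drop i p); split => //.
  by rewrite size_drop sp e addKn.
have := dist_triangle z x y; exists z; lia.
Qed.

Lemma dist_pred x y k : dist x y = k.+1 -> exists2 z, adj y z & dist x z = k.
Proof.
rewrite -addn1 => /dist_split[z h1 h2]; exists z => //.
by rewrite adj_sym; apply: dist1.
Qed.

End Distance.

(** * Sphere sizes and the tree structure below distance D *)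

Section MooreTree.

Variables (G : sgraph) (d D : nat).
Hypothesis diam : forall x y : G, exists2 k, distance_is x y k & k <= D.
Hypothesis deg_le : forall x : G, degree x <= d.
Hypothesis order : #|G| + 2 = moore_bound d D.
Hypotheses (d_gt3 : 3 < d) (D_gt3 : 3 < D).

Local Notation dist := (dist diam).

Definition up (x y : G) := #|[set z | adj y z & dist x z == (dist x y).+1]|.
Definition low (x y : G) := #|[set z | adj y z & (dist x z).+1 == dist x y]|.
Definition sphere (x : G) k := #|[set y | dist x y == k]|.
(** Sphere sizes in the infinite d-regular tree. *)
Definition level k := if k is j.+1 then d * (d - 1) ^ j else 1.

Lemma up_low x y : up x y + low x y <= degree y.
Proof.
rewrite -cardsUI (_ : _ :&: _ = set0) ?cards0 ?addn0; last first.
  by apply/setP => z; rewrite !inE; case: (adj y z) => //=; lia.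
by apply/subset_leq_card/subsetP => z; rewrite !inE; case: (adj y z).
Qed.

Lemma low_gt0 x y : 0 < dist x y -> 0 < low x y.
Proof.
case e : (dist x y) => [//|k] _; have [z a h] := dist_pred e.
by apply/card_gt0P; exists z; rewrite inE a h e eqxx.
Qed.

Lemma up_le x y : 0 < dist x y -> up x y <= d - 1.
Proof. move=> /low_gt0; have := up_low x y; have := deg_le y; lia. Qed.

(** Both sides count the edges between two consecutive spheres about x. *)
Lemma up_sphere x k :
  \sum_(y | dist x y == k) up x y = \sum_(z | dist x z == k.+1) low x z.
Proof.
under eq_bigr => y _ do rewrite /up -sum1dep_card.
under [RHS]eq_bigr => y _ do rewrite /low -sum1dep_card.
rewrite (exchange_big_dep (fun z => dist x z == k.+1)) /=; last first.
  by move=> y z /eqP -> /andP[].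
apply: eq_bigr => z /eqP ez; apply: eq_bigl => y.
rewrite ez adj_sym eqSS.
by rewrite eqSS (eq_sym k) andbCA andbb.
Qed.

Lemma sum_sphere_le x k : sphere x k.+1 <= \sum_(z | dist x z == k.+1) low x z.
Proof.
rewrite /sphere cardsE -sum1_card; apply: leq_sum => z /eqP e.
by apply: low_gt0; rewrite e.
Qed.

Lemma sum_up_le x k :
  \sum_(y | dist x y == k.+1) up x y <= sphere x k.+1 * (d - 1).
Proof.
rewrite /sphere cardsE -sum_nat_const; apply: leq_sum => z /eqP e.
by apply: up_le; rewrite e.
Qed.

Lemma sphere_step x k : sphere x k.+2 <= sphere x k.+1 * (d - 1).
Proof. by apply: leq_trans (sum_sphere_le x _) _; rewrite -up_sphere sum_up_le. Qed.

Lemma sphere0 x : sphere x 0 = 1.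
Proof.
rewrite /sphere (_ : [set y | _] = [set x]) ?cards1 //.
by apply/setP => y; rewrite !inE; apply/eqP/eqP => [/dist0 //|->]; rewrite distxx.
Qed.

Lemma sphere1 x : sphere x 1 = degree x.
Proof.
apply: eq_card => y; rewrite !inE; apply/eqP/idP => [/dist1 //|].
exact: dist_adj.
Qed.

Lemma level_step k : level k.+2 = level k.+1 * (d - 1).
Proof. by rewrite /= expnSr mulnA. Qed.

Lemma sphere_le x k : sphere x k <= level k.
Proof.
case: k => [|k]; first by rewrite sphere0.
elim: k => [|k IH]; first by rewrite sphere1 /= expn0 muln1.
by apply: leq_trans (sphere_step x k) _; rewrite level_step leq_mul2r IH orbT.
Qed.

Lemma sum_sphere x : \sum_(k < D.+1) sphere x k = #|G|.
Proof.
rewrite -sum1_card (partition_big (fun y => inord (dist x y) : 'I_D.+1) predT) //=.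
apply: eq_bigr => k _; rewrite /sphere cardsE -sum1_card; apply: eq_bigl => y.
by rewrite -val_eqE /= inordK // ltnS dist_le_diam.
Qed.

Lemma sum_level : \sum_(k < D.+1) level k = moore_bound d D.
Proof. by rewrite big_ord_recl /= /moore_bound big_mkord big_distrr. Qed.

(* A deficit of one vertex at level k costs d - 1 > 2 more at level k + 1. *)
Lemma sphere_level x k : k < D -> sphere x k = level k.
Proof.
move=> kD; apply/eqP; rewrite eqn_leq sphere_le leqNgt; apply/negP => lt.
have lt1 : sphere x k.+1 + (d - 1) <= level k.+1.
  case: k kD lt => [_|k kD lt]; first by rewrite sphere0.
  have := sphere_step x k; rewrite level_step; nia.
have kD1 : k < D.+1 by lia.
have := sum_sphere x; have := sum_level.
rewrite (bigD1 (Ordinal kD1)) //= (bigD1 (Ordinal (kD : k.+1 < D.+1))) /=; last first.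
  by rewrite -val_eqE /=; lia.
rewrite [in X in _ -> X](bigD1 (Ordinal kD1)) //=.
rewrite [in X in _ -> X](bigD1 (Ordinal (kD : k.+1 < D.+1))) /=; last first.
  by rewrite -val_eqE /=; lia.
set s := (X in _ + (_ + X) = moore_bound _ _ -> _).
set t := (X in _ -> _ + (_ + X) = _ -> _).
have : t <= s by apply: leq_sum => i _; apply: sphere_le.
rewrite -[d * _]/(level k.+1) => le e1 e2.
move: order; rewrite -e1 -e2; lia.
Qed.

Lemma degreeE (x : G) : degree x = d.
Proof. by rewrite -sphere1 sphere_level; [rewrite /= muln1 | lia]. Qed.

(** Both spheres have the size they have in the tree, so the chain from [sphere x k.+2] through the
    sums of [low] and [up] to [sphere x k.+1 * (d - 1)] is tight, and every summand attains its
    bound. *)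
Lemma low_up_eq x k : k.+2 < D ->
  (forall y, dist x y = k.+1 -> up x y = d - 1) /\
  (forall y, dist x y = k.+2 -> low x y = 1).
Proof.
move=> kD; have e1 : sphere x k.+1 * (d - 1) = sphere x k.+2.
  by rewrite !sphere_level ?level_step //; lia.
have le1 := sum_sphere_le x k.+1; have le2 := sum_up_le x k.
rewrite up_sphere in le2.
have e2 : \sum_(z | dist x z == k.+2) low x z = sphere x k.+2 by lia.
split=> y /eqP ey.
  have L : \sum_(y | dist x y == k.+1) up x y
     <= \sum_(y | dist x y == k.+1) (d - 1)
     ?= iff [forall (y | dist x y == k.+1), up x y == d - 1].
    apply: leqif_sum => z /eqP ez; split=> //; apply: up_le; by rewrite ez.
  have := L.2; rewrite up_sphere e2 sum_nat_const -e1 /sphere cardsE eqxx.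
  by move=> /esym /forall_inP /(_ y ey) /eqP.
have L : \sum_(y | dist x y == k.+2) 1
   <= \sum_(y | dist x y == k.+2) low x y
   ?= iff [forall (y | dist x y == k.+2), 1 == low x y].
  by apply: leqif_sum => z /eqP ez; split=> //; apply: low_gt0; rewrite ez.
have := L.2; rewrite e2 sum1_card /sphere cardsE eqxx.
by move=> /esym /forall_inP /(_ y ey) /eqP.
Qed.

Lemma low_eq1 x y : 0 < dist x y < D -> low x y = 1.
Proof.
case/andP; case e : (dist x y) => [|[|k]] // _ kD; last exact: (low_up_eq x kD).2.
rewrite /low (_ : [set z | _] = [set x]) ?cards1 //.
apply/setP => z; rewrite !inE e eqSS; apply/andP/eqP => [[_ /eqP /dist0 //]|->].
by rewrite distxx adj_sym (dist1 e).
Qed.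

Lemma low_uniq x y z1 z2 : adj y z1 -> adj y z2 -> 0 < dist x y < D ->
  dist x z1 < dist x y -> dist x z2 < dist x y -> z1 = z2.
Proof.
move=> a1 a2 h l1 l2; have /eqP/cards1P[u hu] := low_eq1 h.
have H z : adj y z -> dist x z < dist x y -> z = u.
  move=> a l; apply/set1P; rewrite -hu inE a /=.
  by have := @dist_step _ _ diam x z y; rewrite adj_sym => /(_ a); lia.
by rewrite (H z1 a1 l1) (H z2 a2 l2).
Qed.

(** For y other than x, [up] and [low] already account for all d neighbours of y. *)
Lemma dist_adj_neq x y z : (dist x y).+1 < D -> adj y z -> dist x z != dist x y.
Proof.
move=> kD a; case e : (dist x y) => [|k].
  by rewrite -(dist0 e) in a; rewrite (dist_adj diam a).
have ex1 := (low_up_eq x (k:=k)); rewrite -e in ex1.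
have u : up x y = d - 1 by apply: (ex1 _).1; rewrite ?e //; lia.
have l : low x y = 1 by apply: low_eq1; lia.
apply/eqP => ez.
have : up x y + low x y < degree y; last by rewrite degreeE; lia.
rewrite -cardsUI (_ : _ :&: _ = set0) ?cards0 ?addn0; last first.
  by apply/setP => t; rewrite !inE; case: (adj y t) => //=; lia.
apply/proper_card/properP; split.
  by apply/subsetP => t; rewrite !inE; case: (adj y t).
by exists z; rewrite !inE a // ez e; lia.
Qed.

(** * The defect matrix *)

Lemma up_eq x y : 0 < dist x y -> (dist x y).+1 < D -> up x y = d - 1.
Proof. by case e : (dist x y) => [//|k] _ kD; apply: (low_up_eq x kD).1. Qed.

(** The matrix product, with natural entries; identities are therefore stated without subtraction
    and used by cancellation. *)
Definition conv (f g : G -> G -> nat) x y := \sum_z f x z * g z y.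
Definition commute f g := forall x y, conv f g x y = conv g f x y.
Definition A (x y : G) : nat := adj x y.
Definition P k (x y : G) : nat := dist x y == k.

Lemma convA f g h x y : conv f (conv g h) x y = conv (conv f g) h x y.
Proof.
rewrite /conv; under eq_bigr => z _ do rewrite big_distrr /=.
rewrite exchange_big /=; apply: eq_bigr => t _; rewrite big_distrl /=.
by apply: eq_bigr => z _; rewrite mulnA.
Qed.

Lemma eq_conv f f' g g' x y : f =2 f' -> g =2 g' -> conv f g x y = conv f' g' x y.
Proof. by move=> e1 e2; apply: eq_bigr => z _; rewrite e1 e2. Qed.

Lemma convDl f f' g x y :
  conv (fun x y => f x y + f' x y) g x y = conv f g x y + conv f' g x y.
Proof. by rewrite -big_split; apply: eq_bigr => z _; rewrite mulnDl. Qed.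

Lemma convDr f g g' x y :
  conv f (fun x y => g x y + g' x y) x y = conv f g x y + conv f g' x y.
Proof. by rewrite -big_split; apply: eq_bigr => z _; rewrite mulnDr. Qed.

Lemma convZl c f g x y : conv (fun x y => c * f x y) g x y = c * conv f g x y.
Proof. by rewrite /conv big_distrr; apply: eq_bigr => z _; rewrite /= mulnA. Qed.

Lemma convZr c f g x y : conv f (fun x y => c * g x y) x y = c * conv f g x y.
Proof. by rewrite /conv big_distrr; apply: eq_bigr => z _; rewrite /= mulnCA. Qed.

Lemma commute_sym f g : commute f g -> commute g f.
Proof. by move=> c x y; rewrite c. Qed.

Lemma convA_card j x y :
  conv A (P j) x y = #|[set z | adj x z & dist y z == j]|.
Proof.
rewrite -sum1dep_card big_mkcond /=; apply: eq_bigr => z _.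
by rewrite /A /P dist_sym mulnb; case: (_ && _).
Qed.

Lemma conv_sym f g x y : (forall x y, f x y = f y x) ->
  (forall x y, g x y = g y x) -> conv f g x y = conv g f y x.
Proof. by move=> fs gs; apply: eq_bigr => z _; rewrite fs gs mulnC. Qed.

Lemma A_sym x y : A x y = A y x. Proof. by rewrite /A adj_sym. Qed.
Lemma P_sym k x y : P k x y = P k y x. Proof. by rewrite /P dist_sym. Qed.

(** The number of children of a vertex at depth k of the tree. *)
Definition branching k := if k is 0 then d else d - 1.

(* The three-term recurrence of the distance polynomials of a regular tree. *)
Lemma convAP k x y : k.+2 < D ->
  conv A (P k.+1) x y = P k.+2 x y + branching k * P k x y.
Proof.
move=> kD; rewrite convA_card /P (dist_sym diam x).
case: (dist y x =P k.+2) => [e|n2].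
  rewrite e (gtn_eqF (leqW (ltnSn k))) muln0 addn0 /=.
  rewrite -(@low_eq1 y x) ?e //; apply: eq_card => z.
  by rewrite !inE e eqSS.
case: (dist y x =P k) => [e|n0] /=; rewrite ?muln1 ?muln0 ?add0n.
  case: k e {n2} kD => [|k] e kD.
    rewrite /= -(degreeE x) (dist0 e); apply: eq_card => z; rewrite !inE.
    by apply/andP/idP => [[]//|a]; rewrite a (dist_adj diam a).
  rewrite /= -(@up_eq y x) ?e //; last by lia.
  by apply: eq_card => z; rewrite !inE e.
apply: eq_card0 => z; rewrite !inE; apply/andP => -[a /eqP e].
have : dist y x != k.+1.
  by apply: contraTneq a => e1; apply/negP => a;
     have /eqP := @dist_adj_neq y x z ltac:(lia) a; lia.
have := dist_step diam y a; rewrite adj_sym in a.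
have := dist_step diam y a; lia.
Qed.

Lemma P1E x y : P 1 x y = A x y.
Proof. by congr nat_of_bool; apply/eqP/idP => [/dist1|/dist_adj]. Qed.

(** By [convAP], [P k] is a polynomial in A; the induction is strong because the recurrence reaches
    two levels back. *)
Lemma commuteP f k : commute A f -> k < D -> commute (P k) f.
Proof.
move=> cA; elim/ltn_ind: k => -[_ _|[_ _|k IH kD]] x y.
- rewrite /conv (bigD1 x) //= [RHS](bigD1 y) //= /P !distxx mul1n muln1.
  rewrite !big1 ?addn0 // => z /eqP n; case: eqP => [/dist0 e|]; rewrite ?muln0 ?mul0n //;
    by case: n.
- by rewrite (@eq_conv _ A f f _ _ P1E) // (@eq_conv f f _ A _ _ _ P1E).
have c1 : commute (P k.+1) f by apply: IH; lia.
have c0 : commute (P k) f by apply: IH; lia.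
have e u v := @convAP k u v kD.
have : conv (conv A (P k.+1)) f x y = conv f (conv A (P k.+1)) x y.
  rewrite -convA (@eq_conv A A _ (conv f (P k.+1))) // convA convA.
  by apply: eq_conv.
rewrite (@eq_conv _ _ f f _ _ e) // (@eq_conv f f _ _ _ _ _ e) //.
by rewrite convDl convDr convZl convZr c0 => /addIn.
Qed.

(** The first product that [convAP] does not cover; [E_card] gives its entries. *)
Definition E := conv A (P D.-1).

Lemma commuteAP : commute (P D.-1) A.
Proof. by apply: commuteP => //; lia. Qed.

Lemma commuteAE : commute A E.
Proof.
move=> x y; rewrite /E -[RHS]convA; apply: eq_conv => // u v.
by rewrite commuteAP.
Qed.

Lemma E_sym x y : E x y = E y x.
Proof. by rewrite /E -commuteAP (conv_sym _ _ (P_sym _) A_sym). Qed.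

Lemma E_card x y : E x y = #|[set z | adj y z & dist x z == D.-1]|.
Proof. by rewrite E_sym /E convA_card. Qed.

(* The defect matrix: the number of non-backtracking walks of length at most
   D from x to y is 1 + B x y. *)
Definition B x y :=
  if dist x y == D then (E x y).-1 else if dist x y == D.-1 then E x y else 0.

Lemma B_sym x y : B x y = B y x.
Proof. by rewrite /B (dist_sym diam x) E_sym. Qed.

Lemma sumP x y : \sum_(k < D) P k x y = (dist x y < D).
Proof.
case: ltnP => [lt|ge].
  rewrite (bigD1 (Ordinal lt)) //= /P eqxx big1 // => i.
  by rewrite -val_eqE /= eq_sym => /negbTE ->.
by rewrite big1 // => i _; rewrite /P gtn_eqF // (leq_trans _ ge).
Qed.

(** Solved for B, this writes B plus the all-ones matrix as a polynomial in A. *)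
Lemma B_eq x y :
  B x y + (1 + (d - 1) * P D.-2 x y) = E x y + \sum_(k < D) P k x y.
Proof.
rewrite sumP /B /P E_card; have := dist_le_diam diam x y.
case: (dist x y =P D) => [e _|n1 le].
  have /card_gt0P : 0 < low x y by apply: low_gt0; lia.
  case=> z; rewrite inE e => /andP[a /eqP ez].
  have : 0 < #|[set z | adj y z & dist x z == D.-1]|.
    by apply/card_gt0P; exists z; rewrite inE a; apply/eqP; lia.
  lia.
case: (dist x y =P D.-1) => [e|n2]; first lia.
case: (dist x y =P D.-2) => [e|n3] /=.
  rewrite (_ : #|_| = d - 1); first lia.
  rewrite -(@up_eq x y) ?e; try lia.
  by apply: eq_card => z; rewrite !inE e (_ : D.-2.+1 = D.-1) //; lia.
rewrite eq_card0; first lia.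
move=> z; rewrite !inE; apply/andP => -[a /eqP e].
have := dist_step diam x a; rewrite adj_sym in a.
have := dist_step diam x a; lia.
Qed.

(** The all-ones matrix commutes with A because G is regular, and the other terms of [B_eq] do as
    polynomials in A. *)
Lemma commuteAB : commute A B.
Proof.
have c1 : commute A (fun _ _ => 1).
  have H x : \sum_z (A x z) * 1 = d.
    rewrite -(degreeE x) /degree -sum1dep_card [RHS]big_mkcond /=.
    by apply: eq_bigr => z _; rewrite /A; case: (adj _ _).
  move=> x y; rewrite /conv H -(H y); apply: eq_bigr => z _.
  by rewrite mulnC A_sym.
have cP k : k < D -> commute A (P k).
  by move=> kD; apply/commute_sym/commuteP.
have cS k : k <= D -> commute A (fun x y => \sum_(i < k) P i x y).
  elim: k => [_|k IH kD] x y.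
    by rewrite /conv !big1 // => z _; rewrite big_ord0 ?muln0.
  pose f x y := \sum_(i < k) P i x y + P k x y.
  have e u v : \sum_(i < k.+1) P i u v = f u v by rewrite big_ord_recr.
  rewrite (@eq_conv A A _ f) // (@eq_conv _ f A A) //.
  by rewrite convDl convDr cP // IH // ltnW.
move=> x y.
pose r x y := E x y + \sum_(i < D) P i x y.
pose c x y := 1 + (d - 1) * P D.-2 x y.
have cr : commute A r by move=> u v; rewrite convDl convDr commuteAE cS.
have cc : commute A c.
  by move=> u v; rewrite convDl convDr c1 convZl convZr cP //; lia.
have := cr x y; rewrite -(@eq_conv A A _ _ x y _ B_eq) //.
by rewrite -(@eq_conv _ _ A A x y B_eq) // convDl convDr cc => /addIn.
Qed.

(** Summing [B_eq] over y and cancelling [level D.-1] leaves the row sum plus the order of G on the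
    left and the Moore bound on the right. *)
Lemma sumB x : \sum_y B x y = 2.
Proof.
have sP u k : k < D -> \sum_y P k u y = level k.
  move=> kD; rewrite -(sphere_level u kD) /sphere -sum1dep_card.
  by rewrite [RHS]big_mkcond; apply: eq_bigr => y _; rewrite /P; case: eqP.
have sA : \sum_z A x z = d.
  rewrite -(degreeE x) /degree -sum1dep_card [RHS]big_mkcond /=.
  by apply: eq_bigr => z _; rewrite /A; case: (adj _ _).
have sE : \sum_y E x y = d * level D.-1.
  rewrite exchange_big /= -sA big_distrl /=; apply: eq_bigr => z _.
  by rewrite -big_distrr sP //; lia.
have e : \sum_y (B x y + (1 + (d - 1) * P D.-2 x y))
  = \sum_y (E x y + \sum_(k < D) P k x y) by apply: eq_bigr => y _; apply: B_eq.
have lD : level D = level D.-1 * (d - 1).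
  by rewrite -[D in LHS](_ : D.-2.+2 = D) ?level_step; [congr (level _ * _) |]; lia.
have lD1 : level D.-1 = level D.-2 * (d - 1).
  rewrite -[D.-1](_ : D.-2.-1.+2 = D.-1) ?level_step; last lia.
  by congr (level _ * _); lia.
move: e; rewrite !big_split /= sE -big_distrr /= sP; last lia.
rewrite sum1_card exchange_big /= (eq_bigr (fun k : 'I_D => level k)); last first.
  by move=> k _; apply: sP.
have := sum_level; rewrite big_ord_recr /= => sl.
have dL : d * level D.-1 = level D + level D.-1.
  by rewrite lD -mulnSr mulnC; congr (_ * _); lia.
move: order; rewrite -sl dL mulnC -lD1 !cardE; lia.
Qed.

(** * Repeats and short cycles seen from a vertex *)

Lemma low_high x y z1 z2 : adj y z1 -> adj y z2 -> z1 != z2 ->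
  0 < dist x y < D -> dist x z1 < dist x y -> dist x y <= dist x z2.
Proof.
move=> a1 a2 n h l1; rewrite leqNgt; apply: contra n => l2.
by rewrite (low_uniq a1 a2 h l1 l2).
Qed.

Lemma B_gt0_dist x y : 0 < B x y -> dist x y = D \/ dist x y = D.-1.
Proof. by rewrite /B; case: (dist x y =P D); case: (dist x y =P D.-1); auto. Qed.

Lemma B_three x a b c : a != b -> 0 < B x a -> 0 < B x b -> 0 < B x c ->
  c = a \/ c = b.
Proof.
move=> ab ha hb hc; case: (eqVneq c a) => [|ca]; first by left.
case: (eqVneq c b) => [|cb]; first by right.
have := sumB x; rewrite (bigD1 a) //= (bigD1 b) /=; last by rewrite eq_sym.
rewrite (bigD1 c) ?ca //=; lia.
Qed.

Lemma B_two x a c : 1 < B x a -> 0 < B x c -> c = a.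
Proof.
move=> ha hc; apply/eqP; apply: contraTT hc => ca.
have := sumB x; rewrite (bigD1 a) //= (bigD1 c) //=; lia.
Qed.

(** Below level D - 1 this is [dist_adj_neq]; at level D - 1 each end of the edge is counted in the
    entry of E at the other end. *)
Lemma adj_same x y z : adj y z -> dist x z = dist x y ->
  D.-1 <= dist x y /\ (dist x y = D.-1 -> 0 < B x y /\ 0 < B x z).
Proof.
move=> a e; split=> [|ey].
  by rewrite leqNgt; apply/negP => lt; have /eqP := @dist_adj_neq x y z ltac:(lia) a.
have H u v : adj u v -> dist x u = D.-1 -> dist x v = D.-1 -> 0 < B x u.
  move=> auv eu ev; rewrite /B eu E_card; case: (D.-1 =P D) => [|_]; first lia.
  rewrite eqxx.
  by apply/card_gt0P; exists v; rewrite inE auv ev eqxx.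
by split; [apply: (H y z) | apply: (H z y)] => //; rewrite 1?adj_sym // e.
Qed.

Lemma low_two x y z1 z2 : adj y z1 -> adj y z2 -> z1 != z2 ->
  dist x z1 < dist x y -> dist x z2 < dist x y -> dist x y = D /\ 0 < B x y.
Proof.
move=> a1 a2 n12 l1 l2; have eD : dist x y = D.
  apply/eqP; rewrite eqn_leq dist_le_diam leqNgt; apply: contra n12 => lt.
  by rewrite (low_uniq a1 a2 _ l1 l2) //; lia.
split=> //; rewrite /B eD eqxx E_card -subn1 subn_gt0.
have H z : adj y z -> dist x z < dist x y -> dist x z = D.-1.
  by rewrite adj_sym => /(dist_step diam x); lia.
by apply/card_gt1P; exists z1, z2; rewrite !inE a1 a2 n12 (H z1 a1 l1) (H z2 a2 l2) eqxx.
Qed.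

Lemma low_pair x y : dist x y = D -> 0 < B x y ->
  exists z1 z2, [/\ adj y z1, adj y z2, z1 != z2,
                    dist x z1 = D.-1 & dist x z2 = D.-1].
Proof.
move=> e; rewrite /B e eqxx E_card -subn1 subn_gt0 => /card_gt1P[z1 [z2]].
by rewrite !inE => -[/andP[a1 /eqP e1] /andP[a2 /eqP e2] n]; exists z1, z2.
Qed.

Lemma B_push k x x' y : k < D -> dist x x' = k -> 0 < B x' y ->
  exists2 y', 0 < B x y' & dist y' y = k.
Proof.
move=> kD e b; have := commuteP commuteAB kD x y.
have : 0 < conv (P k) B x y.
  by rewrite /conv (bigD1 x') //= {1}/P e eqxx mul1n; lia.
move=> /[swap] ->; rewrite lt0n sum_nat_eq0 negb_forall => /existsP[z /=].
rewrite muln_eq0 negb_or /P eqb0 negbK => /andP[bz /eqP ez].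
by exists z; rewrite ?lt0n.
Qed.

Lemma B_push1 x x' y : adj x x' -> 0 < B x' y ->
  exists2 y', 0 < B x y' & adj y' y.
Proof.
move=> /(dist_adj diam) a b.
by have [|y' ? /dist1] := B_push _ a b; [lia | exists y'].
Qed.

Lemma triangle_free (a b c : G) : adj a b -> adj b c -> ~~ adj a c.
Proof.
move=> ab bc; apply/negP => ac.
have := adj_same (x := a) bc; rewrite (dist_adj diam ab) (dist_adj diam ac); lia.
Qed.

Lemma dist2 (a b c : G) : adj a b -> adj b c -> a != c -> dist a c = 2.
Proof.
move=> ab bc n; have := dist_step diam a bc; rewrite (dist_adj diam ab).
have := triangle_free ab bc.
case e : (dist a c) => [|[|[|]]] //; first by rewrite (dist0 e) eqxx in n.
by rewrite (dist1 e).
Qed.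

Lemma square_free (a b c e : G) : adj a b -> adj b c -> adj c e -> adj e a ->
  a = c \/ b = e.
Proof.
move=> ab bc ce ea; case: (eqVneq a c) => [|n]; [by left | right].
have d2 := dist2 ab bc n; rewrite adj_sym in ea; rewrite adj_sym in bc.
apply: (low_uniq (x := a) bc ce); rewrite d2 ?(dist_adj diam ab) ?(dist_adj diam ea) //.
lia.
Qed.

Lemma other_neighbour (y a b : G) : exists g, [/\ adj y g, g != a & g != b].
Proof.
have : 0 < #|[set g | adj y g] :\: [set a; b]|.
  have := degreeE y; rewrite /degree -(cardsID [set a; b]).
  have := subset_leq_card (subsetIr [set g | adj y g] [set a; b]).
  by rewrite cards2; lia.
by case/card_gt0P => g; rewrite !inE negb_or => /andP[/andP[? ?] ?]; exists g.
Qed.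

(* Let C be the short cycle through g and h, v the vertex of C two steps from g
   and z its antipode.  The repeat of v other than z is two steps from k and
   D - 2 steps from w, unless z itself is close to k or to w. *)
Lemma parallel_cycle g h k w : dist g h = D ->
  0 < B g h -> 0 < B g k -> 0 < B h w -> h != k -> g != w ->
  (exists z, [/\ dist h z = 2, dist g z = D - 2
                & dist z k = 2 \/ dist z w = D - 2]) \/
  (exists v u, [/\ dist g v = 2, dist v h = D - 2, 0 < B v u,
                  dist u k = 2 & dist u w = D - 2]).
Proof.
move=> gh bgh bgk bhw hk gw.
(* The neighbours of h on C; v is taken on the side of n1 and z on the side of n2. *)
have [n1 [n2 [a1 a2 n12 e1 e2]]] := low_pair gh bgh.
have [v gv vn1] : exists2 v, dist g v = 2 & dist v n1 = D - 3.
  by apply: dist_split; lia.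
have [z gz zn2] : exists2 z, dist g z = D - 2 & dist z n2 = 1.
  by apply: dist_split; lia.
have an2z : adj n2 z by rewrite adj_sym; apply: dist1 zn2.
have vh : dist v h = D - 2.
  have := dist_triangle diam v g h; rewrite adj_sym in a1.
  have := dist_step diam v a1; lia.
have hz : dist h z = 2.
  have := dist_triangle diam z g h; have := dist_step diam h an2z.
  rewrite (dist_adj diam a2) (dist_sym diam z); lia.
have vn2 : dist v n2 = D.-1.
  have := dist_step diam v a2.
  have := adj_same (x := v) a2.
  have := @low_high v h n1 n2 a1 a2 n12; lia.
have vz : D.-1 <= dist v z.
  have hn : adj n2 h by rewrite adj_sym.
  have nhz : h != z by apply: contra_eqN hz => /eqP ->; rewrite distxx.
  have := @low_high v n2 h z hn an2z nhz; lia.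
have bvz : 0 < B v z.
  case: (eqVneq (dist v z) D.-1) => [e|n].
    by have [_ /(_ vn2)[]] := @adj_same v n2 z an2z ltac:(lia).
  (* At distance D from v, z has two neighbours nearer to v: y towards g and n2 towards h. *)
  have [y ay ey] := @dist_pred _ _ diam g z (D - 3) ltac:(lia).
  have l : dist v y <= D.-1.
    have := dist_triangle diam g v y; rewrite (dist_sym diam v g); lia.
  have yn : y != n2 by apply: contraTneq isT => yn; rewrite yn in ey; lia.
  have azn2 : adj z n2 by rewrite adj_sym.
  have lez := dist_le_diam diam v z.
  by apply: (low_two ay azn2 yn _ _).2; move/eqP: n; lia.
(* The repeats k of g and w of h are carried over to repeats u and u' of v; as v has only two
   repeats, z, u and u' cannot all differ. *)
have [u bu uk] : exists2 u, 0 < B v u & dist u k = 2.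
  by apply: B_push bgk; [lia | rewrite dist_sym].
have [u' bu' uw] : exists2 u, 0 < B v u & dist u w = D - 2.
  by apply: B_push bhw; [lia | ].
case: (eqVneq z u) => [zu|nzu]; first by left; exists z; split; rewrite // zu; left.
case: (B_three nzu bvz bu bu') => e; first by left; exists z; split; rewrite // -e; right.
by right; exists v, u; split; rewrite // -e.
Qed.

(** * Cycles of length 2D - 1 *)

(* If dist x y = D - 1 then B x y counts the walks of length D from x to y, each
   of which closes a (2D-1)-cycle. *)
Definition odd_vertex x := exists2 y, 0 < B x y & dist x y = D.-1.

(** The edge from y to y' lies opposite x on a (2D-1)-cycle. *)
Lemma odd_pair x y : 0 < B x y -> dist x y = D.-1 ->
  exists y', [/\ adj y y', dist x y' = D.-1 & 0 < B x y'].
Proof.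
move=> b e; move: (b); rewrite {1}/B e eqxx E_card.
case: eqP => [|_ /card_gt0P[z]]; first lia.
rewrite inE => /andP[a /eqP ez]; exists z; split=> //.
by have [_ /(_ e)[]] := adj_same a (etrans ez (esym e)).
Qed.

Lemma odd_pairC x y : 0 < B x y -> dist x y = D.-1 ->
  exists x', [/\ adj x x', dist y x' = D.-1 & 0 < B y x'].
Proof. by rewrite B_sym dist_sym; apply: odd_pair. Qed.

Lemma odd_dist x r : odd_vertex x -> 0 < B x r -> dist x r = D.-1.
Proof.
case=> y b e br; have [y' [a e' b']] := odd_pair b e.
by case: (B_three (adj_neq a) b b' br) => ->.
Qed.

Lemma odd_adj x r s : odd_vertex x -> 0 < B x r -> 0 < B x s -> r != s -> adj r s.
Proof.
case=> y b e br bs rs; have [y' [a e' b']] := odd_pair b e.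
case: (B_three (adj_neq a) b b' br) (B_three (adj_neq a) b b' bs) rs.
  by move=> -> [->|->]; rewrite ?eqxx.
by move=> -> [->|->]; rewrite ?eqxx // adj_sym.
Qed.

Lemma odd_repeat x r : odd_vertex x -> 0 < B x r -> odd_vertex r.
Proof.
by move=> ox b; exists x; [rewrite B_sym | rewrite dist_sym; apply: odd_dist].
Qed.

(** Turning the cycle by one step: the edge from y to y0 lies opposite the neighbour x' of x. *)
Lemma odd_lower x y y0 : 0 < B x y -> dist x y = D.-1 -> adj y y0 ->
  dist x y0 = D.-2 -> odd_vertex y0.
Proof.
move=> b e a e0; have [x' [ax ex bx]] := odd_pairC b e.
have e' : dist x' y0 = D.-1.
  have ne : dist y0 x' != dist y0 x.
    by apply: dist_adj_neq ax; rewrite dist_sym; lia.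
  have := dist_step diam y0 ax; rewrite !(dist_sym diam y0) in ne *.
  have := dist_step diam x' a; rewrite adj_sym in a.
  have := dist_step diam x' a; rewrite (dist_sym diam x' y); lia.
have ey : dist x' y = D.-1 by rewrite dist_sym.
have [_ /(_ ey)[_ b']] := adj_same a (etrans e' (esym ey)).
by exists x'; [rewrite B_sym | rewrite dist_sym].
Qed.

Lemma odd_off x y h : 0 < B x y -> dist x y = D.-1 -> adj y h ->
  ~ odd_vertex h -> dist x h = D.
Proof.
move=> b e a nh; have n1 : dist x h <> D.-1.
  move=> eh; apply: nh; exists x; last by rewrite dist_sym.
  by rewrite B_sym; have [_ /(_ e)[]] := adj_same a (etrans eh (esym e)).
have n2 : dist x h <> D.-2 by move=> eh; apply/nh/(odd_lower b e a eh).
have := dist_step diam x a; rewrite adj_sym in a.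
have := dist_step diam x a; lia.
Qed.

(* With q on a (2D-1)-cycle and q2, q3 its repeats, q4 is the neighbour of q on
   the geodesic from q to q3. *)
Lemma odd_opposite q q2 q3 q4 : adj q2 q3 -> dist q q2 = D.-1 -> dist q q3 = D.-1 ->
  0 < B q q2 -> adj q q4 -> dist q2 q4 = D.-1 -> 0 < B q2 q4 -> dist q3 q4 = D.-2.
Proof.
move=> a23 e2 e3 b2 a4 e24 b24.
have [q5 a5 e5] := @dist_pred _ _ diam q3 q (D.-2) ltac:(rewrite dist_sym; lia).
have e25 : dist q2 q5 = D.-1.
  have n1 : dist q5 q2 <> D.-2.
    by rewrite adj_sym in a23; have /eqP := @dist_adj_neq q5 q3 q2
      ltac:(rewrite dist_sym; lia) a23; rewrite (dist_sym diam q5 q3) e5.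
  have := dist_step diam q2 a5; rewrite adj_sym in a5.
  have := dist_step diam q2 a5; rewrite !(dist_sym diam q2) e2.
  have := dist_step diam q5 a23; rewrite adj_sym in a23.
  have := dist_step diam q5 a23; rewrite (dist_sym diam q5 q3) e5; lia.
have q2q : dist q2 q = D.-1 by rewrite dist_sym.
have [b5 _] : 0 < B q2 q5 /\ 0 < B q2 q.
  by have [_ /(_ q2q)[]] := adj_same a5 (etrans e25 (esym q2q)).
have bq : 0 < B q2 q by rewrite B_sym.
case: (B_three (adj_neq a4) bq b24 b5) => [e|<- //].
by move: a5; rewrite e adj_irrefl.
Qed.

(* Each boolean hypothesis multiplies the number of cases that lia explores. *)
Local Ltac dlia :=
  repeat match goal with
  | H : is_true (adj _ _) |- _ => clear H
  | H : is_true (~~ adj _ _) |- _ => clear H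
  | H : is_true (_ != _) |- _ => clear H
  | H : is_true (0 < B _ _) |- _ => clear H
  | H : odd_vertex _ |- _ => clear H
  | H : ~ odd_vertex _ |- _ => clear H
  | H : _ \/ _ |- _ => clear H
  | H : forall _, _ |- _ => clear H
  end; lia.

(** The configuration is the (2D-1)-cycle through q, q2, q3; the vertices g, h, k, w are adjacent to
    q, q2, q3, q4 respectively. *)
Lemma no_odd_vertex q : ~ odd_vertex q.
Proof.
case=> q2 b2 e2; have [q3 [a23 e3 b3]] := odd_pair b2 e2.
have [q4 [a4 e24 b24]] := odd_pairC b2 e2.
have [q6 [a6 e36 b36]] := odd_pairC b3 e3.
have a32 : adj q3 q2 by rewrite adj_sym.
have e34 := odd_opposite a23 e2 e3 b2 a4 e24 b24.
have oq : odd_vertex q by exists q2.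
have oq2 : odd_vertex q2 := odd_repeat oq b2.
have oq4 : odd_vertex q4 := odd_repeat oq2 b24.
have b2' : 0 < B q2 q by rewrite B_sym.
have b3' : 0 < B q3 q by rewrite B_sym.
(* The neighbours of q on the (2D-1)-cycle are q4 and q6. *)
have [g [ag g4 g6]] := other_neighbour q q4 q6.
have agq : adj g q by rewrite adj_sym.
have [h bgh ah2] := B_push1 agq b2.
have [k bgk ak3] := B_push1 agq b3.
have [w bhw aw4] := B_push1 ah2 b24.
have a2h : adj q2 h by rewrite adj_sym.
have a3k : adj q3 k by rewrite adj_sym.
have rep3 z : 0 < B z q3 -> z = q \/ z = q6.
  by rewrite B_sym; apply: B_three b3' b36; apply: adj_neq.
have rep2 z : 0 < B z q2 -> z = q \/ z = q4.
  by rewrite B_sym; apply: B_three b2' b24; apply: adj_neq.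
have repq z : 0 < B z q -> z = q2 \/ z = q3.
  by rewrite B_sym; apply: B_three b2 b3; apply: adj_neq.
have gq : g != q := adj_neq agq.
have h3 : h != q3.
  by apply: contraTneq bgh => ->; apply/negP => /rep3[] /eqP; apply/negP.
have k2 : k != q2.
  by apply: contraTneq bgk => ->; apply/negP => /rep2[] /eqP; apply/negP.
have hk : h != k.
  by apply: contraTneq ah2 => ->; rewrite (triangle_free ak3 a32).
have ag4 : ~~ adj g q4 by apply: triangle_free agq a4.
have gw : g != w by apply: contraNneq ag4 => ->.
(* Otherwise the repeats h and k of g would be adjacent and close a 4-cycle with q2 and q3. *)
have ng : ~ odd_vertex g.
  move=> og; have ahk := odd_adj og bgh bgk hk.
  by rewrite adj_sym in ahk; case: (square_free ah2 a23 a3k ahk) => /eqP; apply/negP;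
     rewrite // eq_sym.
have dgh : dist g h = D.
  by case: (B_gt0_dist bgh) => // e; case: ng; exists h.
have bhg : 0 < B h g by rewrite B_sym.
have nh : ~ odd_vertex h by move=> oh; apply: ng; apply: odd_repeat bhg.
have nk : ~ odd_vertex k by move=> ok; apply: ng; apply: (odd_repeat ok); rewrite B_sym.
have dhq : dist h q = D by rewrite dist_sym; apply: odd_off a2h nh.
have dkq : dist k q = D by rewrite dist_sym; apply: odd_off a3k nk.
have b42 : 0 < B q4 q2 by rewrite B_sym.
have dhq4 : dist h q4 = D.
  by rewrite dist_sym; apply: odd_off b42 _ a2h nh; rewrite dist_sym.
have dk3 := dist_adj diam ak3; have dh2 := dist_adj diam ah2.
have kq2 : dist k q2 = 2 by apply: dist2 ak3 a32 _.
have hq3 : dist h q3 = 2 by apply: dist2 ah2 a23 _.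
case: (parallel_cycle dgh bgh bgk bhw hk gw) => [[z [hz gz]]|[v [u]]].
  case=> [zk|zw].
    (* Here z is at distance 3 from both ends of the edge q2 q3. This forces D = 4 and makes z a
       repeat of q2, hence q or q4, which are too far from h. *)
    have zq2 : dist z q2 = 3.
      have kz : dist k z = 2 by rewrite dist_sym.
      have n1 : dist z q2 <> 1.
        move=> /dist1 a; have := @adj_same k z q2 a; rewrite kz kq2; dlia.
      have n2 : dist z q2 <> 2.
        move=> e; have := @adj_same z h q2 ah2; rewrite e (dist_sym diam z); dlia.
      have n0 : dist z q2 <> 0.
        by move=> /dist0 e; move: hz; rewrite e dh2.
      have := dist_step diam z ah2; rewrite (dist_sym diam z h); dlia.
    have zq3 : dist z q3 = 3.
      have n1 : dist z q3 <> 1.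
        move=> /dist1 a; have := @adj_same h z q3 a; rewrite hz hq3; dlia.
      have n2 : dist z q3 <> 2.
        move=> e; have := @adj_same z k q3 ak3; rewrite e zk; dlia.
      have n0 : dist z q3 <> 0.
        by move=> /dist0 e; move: zk; rewrite e dist_sym dk3.
      have := dist_step diam z ak3; rewrite zk; dlia.
    have [le] := adj_same (x := z) a23 (etrans zq3 (esym zq2)).
    rewrite zq2 in le * => /(_ ltac:(dlia)) [/rep2 [] e _].
      by move: hz; rewrite e dhq; dlia.
    by move: hz; rewrite e dhq4; dlia.
  (* Here z is at distance D - 1 from both ends of the edge q q4, so it is a repeat of q; but q2 is
     too close to h, and q3 too close to q4. *)
  have zg : dist z g = D - 2 by rewrite dist_sym.
  have zq : dist z q = D.-1.
    have := dist_triangle diam z h q; have := dist_step diam z agq.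
    have := adj_same (x := z) agq; dlia.
  have zq4 : dist z q4 = D.-1.
    have := dist_triangle diam z h q4; have := dist_step diam z aw4.
    have := adj_same (x := z) aw4; dlia.
  have [_ /(_ zq)[/repq [] e _]] := adj_same (x := z) a4 (etrans zq4 (esym zq)).
    by move: hz; rewrite e dh2.
  by move: zq4; rewrite e e34; dlia.
case=> gv vh buv uk uw.
have bvu : 0 < B u v by rewrite B_sym.
(* If u is adjacent to q3, then v is adjacent to a repeat of q3: q is too far from h, and q6 would
   be at the same distance 2 from g as v. *)
have [u3|nu3] := eqVneq (dist u q3) 1.
  have a3u : adj q3 u by rewrite adj_sym; apply: dist1 u3.
  have [s bs av] := B_push1 a3u bvu.
  rewrite B_sym in bs; have av' : adj v s by rewrite adj_sym.
  case: (rep3 s bs) => e; rewrite e in av av'.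
    have := dist_step diam h av'; rewrite dhq (dist_sym diam h); dlia.
  have g6' : dist g q6 = 2 by apply: dist2 agq a6 g6.
  have := @adj_same g v q6 av'; dlia.
(* It turns out that m is at distance D from q4 while its neighbours u and k are nearer, so m is a
   repeat of q4; the repeats of q4 are at distance D - 1. *)
have [m um mk] : exists2 m, dist u m = 1 & dist m k = 1 by apply: dist_split; dlia.
have ak : dist q4 k = D.-1.
  have e43 : dist q4 q3 = D.-2 by rewrite dist_sym.
  have := dist_triangle diam q4 k q; rewrite (dist_sym diam k q4).
  rewrite (dist_sym diam q4 q) (dist_adj diam a4).
  have := dist_step diam q4 a3k; have := adj_same (x := q4) a3k.
  have := dist_step diam q4 ak3; dlia.
have akm : adj k m by rewrite adj_sym; apply: dist1 mk.
have amu : adj m u by rewrite adj_sym; apply: dist1 um.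
have amk : adj m k by apply: dist1 mk.
have m3 : q3 != m.
  by apply: contra_neq nu3 => ->.
have le4m : D.-1 <= dist q4 m.
  have := @low_high q4 k q3 m ak3 akm m3; rewrite (dist_sym diam q4 q3); dlia.
have nk4 : ~ 0 < B q4 k by move=> b; apply/nk/(odd_repeat oq4 b).
have n4m : dist q4 m <> D.-1.
  move=> e; have [_] := adj_same (x := q4) akm (etrans e (esym ak)).
  by move=> /(_ ak)[].
have d4m : dist q4 m = D by have := dist_le_diam diam q4 m; dlia.
have d4u : dist q4 u <= D.-1.
  have := dist_triangle diam w q4 u; rewrite (dist_sym diam w u) uw.
  rewrite (dist_sym diam q4 w) (dist_adj diam aw4); dlia.
have uk' : u != k by apply: contra_eqN uk => /eqP ->; rewrite distxx.
have [_ b] := @low_two q4 m u k amu amk uk' ltac:(dlia) ltac:(dlia).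
have := odd_dist oq4 b; dlia.
Qed.

Lemma B_dist x y : 0 < B x y -> dist x y = D.
Proof. by move=> b; case: (B_gt0_dist b) => // e; case: (@no_odd_vertex x); exists y. Qed.

(** * Repeats joined by three geodesics *)

Lemma adj_level x y z : adj y z -> dist x y < D -> dist x z <> dist x y.
Proof.
move=> a lt e; have [le H] := adj_same a e.
have [/B_dist b _] := H ltac:(dlia); dlia.
Qed.

(** Both ends move one step in the same sense round a 2D-cycle; y' then has two neighbours nearer to
    x', namely y and the next vertex towards x. *)
Lemma antipode_step x y x' y' : 0 < B x y -> adj x x' -> dist x' y = D.-1 ->
  adj y y' -> dist x y' = D.-1 -> dist x' y' <> D.-2 -> 0 < B x' y'.
Proof.
move=> b ax e ay e' n; have eD := B_dist b.
have d' : dist x' y' = D.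
  have := adj_level (x := x') ay; have := dist_step diam x' ay.
  rewrite adj_sym in ay; have := dist_step diam x' ay; dlia.
have [l al el] := @dist_pred _ _ diam x y' D.-2 ltac:(dlia).
have ay' : adj y' y by rewrite adj_sym.
have yl : y != l by apply: contra_eqN el => /eqP <-; dlia.
apply: (low_two ay' al yl _ _).2; first dlia.
have := dist_triangle diam x x' l; rewrite (dist_sym diam x' x) (dist_adj diam ax); dlia.
Qed.

Lemma B_single x a b : a != b -> 0 < B x a -> 0 < B x b -> B x a = 1.
Proof.
move=> ab ha hb; have := sumB x; rewrite (bigD1 a) //= (bigD1 b) /=; last by rewrite eq_sym.
lia.
Qed.

Lemma three_low x y z1 z2 z3 : adj y z1 -> adj y z2 -> adj y z3 ->
  dist x z1 = D.-1 -> dist x z2 = D.-1 -> dist x z3 = D.-1 ->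
  z1 != z2 -> z2 != z3 -> z3 != z1 -> dist x y = D -> 1 < B x y.
Proof.
move=> a1 a2 a3 e1 e2 e3 n12 n23 n31 e; rewrite /B e eqxx E_card.
rewrite -subn1 ltn_subRL; apply/card_gt2P; exists z1, z2, z3.
by rewrite !inE a1 a2 a3 e1 e2 e3 eqxx.
Qed.

(** The geodesics through e and f form a 2D-cycle on which a and f are antipodes. *)
Lemma theta_cross x y a e f : 1 < B x y -> adj y e -> adj y f -> e != f ->
  dist x e = D.-1 -> dist x f = D.-1 -> adj x a -> dist a e = D.-2 ->
  dist a y = D.-1 /\ 0 < B a f.
Proof.
move=> b ae af ef xe xf ax aed; have bxy : 0 < B x y := ltnW b.
have eD := B_dist bxy.
have ay : dist a y = D.-1.
  have := dist_triangle diam a x y; rewrite (dist_adj diam ax).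
  rewrite adj_sym in ae; have := dist_step diam a ae; dlia.
split=> //; apply: (antipode_step bxy ax ay af xf).
have := @low_high a y e f ae af ef; dlia.
Qed.

(* Otherwise h lies on the geodesic from x to f, and its repeats would be g and l;
   but one of its repeats is adjacent to a'. *)
Lemma theta_off x y a e l f a' g h : 1 < B x y -> adj y e -> adj y f -> e != f ->
  dist x e = D.-1 -> dist x f = D.-1 -> adj x a -> dist a e = D.-2 ->
  adj a l -> dist l e = D - 3 -> adj a g -> g != x -> g != l ->
  adj x a' -> a != a' -> 0 < B a' f -> 0 < B g h -> adj f h ->
  [/\ h != y, dist x h <> D.-2 &
      forall c, adj x c -> dist c y = D.-1 -> B c f = 1 -> dist c h = D].
Proof.
move=> b ae af ef xe xf ax aed al le ag gx gl ax' aa' ba' bgh ah.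
have [ay baf] := theta_cross b ae af ef xe xf ax aed.
have hy : h != y.
  by apply: contra_neq gx => ehy; rewrite ehy in bgh; apply: (@B_two y); rewrite B_sym.
have daf := B_dist baf; have fy : adj f y by rewrite adj_sym.
have lx : l != x by apply/eqP => elx; rewrite elx in le; dlia.
have xh : dist x h <> D.-2.
  move=> xh; have ly : dist l y = D.-2.
    have := dist_triangle diam l a y; rewrite (dist_adj diam al).
    rewrite adj_sym in ae; have := dist_step diam l ae; dlia.
  have lf : dist l f = D.-1.
    have := dist_step diam l af; have := adj_level (x := l) af.
    have := @low_high l y e f ae af ef; dlia.
  have ah1 : dist a h = D.-1.
    have := dist_triangle diam x a h; rewrite (dist_sym diam a x) (dist_adj diam ax).
    have hf : adj h f by rewrite adj_sym.
    have := dist_step diam a hf; dlia.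
  have yh : y != h by rewrite eq_sym.
  have lh : dist l h <> D.-2.
    have := @low_high l f y h fy ah yh; dlia.
  have blh := antipode_step baf al lf ah ah1 lh.
  have hf : adj h f by rewrite adj_sym.
  have bfa' : 0 < B f a' by rewrite B_sym.
  have [w bhw awa'] := B_push1 hf bfa'.
  have xa' : adj a' x by rewrite adj_sym.
  rewrite B_sym in bgh; rewrite B_sym in blh.
  case: (B_three gl bgh blh bhw) => ew; rewrite ew in awa'.
    by case: (square_free ag awa' xa' ax) => /eqP; apply/negP.
  by case: (square_free al awa' xa' ax) => /eqP; apply/negP.
split=> // c ac cy bc; have bc0 : 0 < B c f by rewrite bc.
have cf := B_dist bc0; apply/eqP/negPn/negP => /eqP nc.
have hf : adj h f by rewrite adj_sym.
have ch : dist c h = D.-1.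
  by have := dist_step diam c hf; have := dist_le_diam diam c h; dlia.
(* The vertices y, l2, h are three neighbours of f at distance D - 1 from c, against [B c f = 1]. *)
have [l2 al2 el2] := @dist_pred _ _ diam x f D.-2 ltac:(dlia).
have cl2 : dist c l2 = D.-1.
  have := dist_triangle diam x c l2; rewrite (dist_sym diam c x) (dist_adj diam ac).
  have al2' : adj l2 f by rewrite adj_sym.
  have := dist_step diam c al2'; dlia.
have yl2 : y != l2.
  by apply: contra_eqN el2 => /eqP <-; have := B_dist (ltnW b); dlia.
have l2h : l2 != h by apply/eqP => e2; apply: xh; rewrite -e2.
by have := three_low fy al2 ah cy cl2 ch yl2 l2h hy cf; rewrite bc.
Qed.

(** The argument of [no_odd_vertex], for three geodesics from x to y, with a1, e2, e3, a3 in the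
    roles of q, q2, q3, q4. *)
Lemma B_le1 x y : B x y <= 1.
Proof.
rewrite leqNgt; apply/negP => b.
have bxy : 0 < B x y := ltnW b.
have eD := B_dist bxy.
have byx : 1 < B y x by rewrite B_sym.
have [e1 [e2 [e3]]] : exists e1 e2 e3,
  [/\ adj y e1 /\ dist x e1 = D.-1, adj y e2 /\ dist x e2 = D.-1,
      adj y e3 /\ dist x e3 = D.-1 & [/\ e1 != e2, e2 != e3 & e3 != e1]].
  move: b; rewrite /B eD eqxx E_card -subn1 ltn_subRL => /card_gt2P[e1 [e2 [e3]]].
  rewrite !inE => -[[/andP[? /eqP ?] /andP[? /eqP ?] /andP[? /eqP ?]] ?].
  by exists e1, e2, e3.
case=> -[y1 x1] [y2 x2] [y3 x3] [n12 n23 n31].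
have H e : dist x e = D.-1 -> exists2 a, adj x a & dist a e = D.-2.
  move=> xe; have [a a1 a2] := @dist_pred _ _ diam e x D.-2 ltac:(rewrite dist_sym; dlia).
  by exists a => //; rewrite dist_sym.
have [[a1 xa1 ae1] [a2 xa2 ae2] [a3 xa3 ae3]] := And3 (H _ x1) (H _ x2) (H _ x3).
have n13 : e1 != e3 by rewrite eq_sym.
have n21 : e2 != e1 by rewrite eq_sym.
have n32 : e3 != e2 by rewrite eq_sym.
have [a1y b12] := theta_cross b y1 y2 n12 x1 x2 xa1 ae1.
have [_ b13] := theta_cross b y1 y3 n13 x1 x3 xa1 ae1.
have [a2y b23] := theta_cross b y2 y3 n23 x2 x3 xa2 ae2.
have [_ b21] := theta_cross b y2 y1 n21 x2 x1 xa2 ae2.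
have [a3y b32] := theta_cross b y3 y2 n32 x3 x2 xa3 ae3.
have [_ b31] := theta_cross b y3 y1 n31 x3 x1 xa3 ae3.
have n_aa a a' e : dist a e = D.-2 -> 0 < B a' e -> a != a'.
  by move=> + /B_dist; case: eqP => // ->; dlia.
have na12 : a1 != a2 := n_aa _ _ _ ae1 b21.
have na13 : a1 != a3 := n_aa _ _ _ ae1 b31.
(* The three geodesics from x to y pass through a1 and e1, a2 and e2, a3 and e3;
   x and l are the neighbours of a1 on the first one. *)
have [l a1l el] := @dist_pred _ _ diam e1 a1 (D - 3) ltac:(rewrite dist_sym; dlia).
rewrite dist_sym in el.
have [g [a1g gx gl]] := other_neighbour a1 x l.
have ga1 : adj g a1 by rewrite adj_sym.
have [h bgh ah2] := B_push1 ga1 b12.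
have [k bgk ak3] := B_push1 ga1 b13.
have e2h : adj e2 h by rewrite adj_sym.
have e3k : adj e3 k by rewrite adj_sym.
have [hy xh offh] := theta_off b y1 y2 n12 x1 x2 xa1 ae1 a1l el a1g gx gl
  xa3 na13 b32 bgh e2h.
have [ky xk offk] := theta_off b y1 y3 n13 x1 x3 xa1 ae1 a1l el a1g gx gl
  xa2 na12 b23 bgk e3k.
have dha1 : dist a1 h = D := offh _ xa1 a1y (B_single n23 b12 b13).
have dha3 : dist a3 h = D := offh _ xa3 a3y (B_single n21 b32 b31).
have dka1 : dist a1 k = D := offk _ xa1 a1y (B_single n32 b13 b12).
have b23' : 0 < B e2 a3 by rewrite B_sym.
have [w bhw aw3] := B_push1 ah2 b23'.
have e2y : adj e2 y by rewrite adj_sym.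
have e3y : adj e3 y by rewrite adj_sym.
have a1x : adj a1 x by rewrite adj_sym.
have a3x : adj a3 x by rewrite adj_sym.
have hk : h != k.
  apply: contraTneq ah2 => ehk; apply/negP => ah2; rewrite -ehk in e3k.
  by case: (square_free ah2 e2y y3 e3k) => /eqP; apply/negP.
have gw : g != w.
  apply: contraTneq ga1 => egw; apply/negP => ga1; rewrite -egw in aw3.
  rewrite adj_sym in aw3.
  by case: (square_free a1x xa3 aw3 ga1) => /eqP; apply/negP; rewrite // eq_sym.
have dgh := B_dist bgh.
have gy : dist g y <> D.-2.
  have lel : dist l y <= D.-2.
    by rewrite adj_sym in y1; have := dist_step diam l y1; rewrite el; dlia.
  have := @low_high y a1 g l a1g a1l gl; rewrite !(dist_sym diam y); dlia.
have dk3 := dist_adj diam ak3; have dh2 := dist_adj diam ah2.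
have ky2 : dist k y = 2 by apply: dist2 ak3 e3y ky.
have hy2 : dist h y = 2 by apply: dist2 ah2 e2y hy.
have ke2 : dist k e2 = 3.
  have := adj_level (x := k) y2; have := dist_step diam k y2.
  have := @low_high k y e3 e2 y3 y2 n32; dlia.
have he3 : dist h e3 = 3.
  have := adj_level (x := h) y3; have := dist_step diam h y3.
  have := @low_high h y e2 e3 y2 y3 n23; dlia.
have gx2 : dist g x = 2 := dist2 ga1 a1x gx.
case: (parallel_cycle dgh bgh bgk bhw hk gw) => [[z [hz gz]]|[v [u]]].
  have zh : dist z h = 2 by rewrite dist_sym.
  have zg : dist z g = D - 2 by rewrite dist_sym.
  have zy : z != y by apply/eqP => ezy; rewrite ezy in gz; dlia.
  have zx : z != x.
    by apply/eqP => ezx; rewrite ezx in zh gz; dlia.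
  case=> [zk|zw].
    have kz : dist k z = 2 by rewrite dist_sym.
    (* Here z is at distance 3 from e2 and e3 and 4 from y, hence a repeat of y; but x is the only
       repeat of y. *)
    have ze2 : dist z e2 = 3.
      have n1 : dist z e2 <> 1.
        move=> /dist1; rewrite adj_sym => e2z; rewrite eq_sym in zy.
        have := @low_high k e2 y z e2y e2z zy; dlia.
      have := adj_level (x := z) ah2; have := dist_step diam z ah2.
      have := dist_step diam z e2h; dlia.
    have ze3 : dist z e3 = 3.
      have n1 : dist z e3 <> 1.
        move=> /dist1; rewrite adj_sym => e3z; rewrite eq_sym in zy.
        have := @low_high h e3 y z e3y e3z zy; dlia.
      have := adj_level (x := z) ak3; have := dist_step diam z ak3.
      have := dist_step diam z e3k; dlia.
    have zy4 : dist z y = 4.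
      have := @low_high z e2 h y e2h e2y hy; have := adj_level (x := z) e2y.
      have := dist_step diam z e2y; dlia.
    have [_] := @low_two z y e2 e3 y2 y3 n23 ltac:(dlia) ltac:(dlia).
    by rewrite B_sym => /(B_two byx) /eqP; apply/negP.
  (* Here z is nearer to a1 and a3 than to x, hence a repeat of x; but y is the only repeat of x. *)
  have za1 : dist z a1 = D.-1.
    have := dist_triangle diam z a1 h; have := adj_level (x := z) ga1.
    have := dist_step diam z ga1; rewrite (dist_sym diam a1 z); dlia.
  have za3 : dist z a3 = D.-1.
    have := dist_triangle diam z a3 h; have := adj_level (x := z) aw3.
    have := dist_step diam z aw3; rewrite (dist_sym diam a3 z); dlia.
  have zxD : dist z x = D.
    have := @low_high z a1 g x a1g a1x gx; have := adj_level (x := z) a1x.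
    have := dist_step diam z a1x; dlia.
  have [_] := @low_two z x a1 a3 xa1 xa3 na13 ltac:(dlia) ltac:(dlia).
  by rewrite B_sym => /(B_two b) /eqP; apply/negP.
case=> gv vh buv uk uw.
(* If u is adjacent to e3, then v is adjacent to a1 or a2: a1 is too far from h, and a2 would force
   v = x, which is not at distance D - 2 from h. *)
have [u3|nu3] := eqVneq (dist u e3) 1.
  have e3u : adj e3 u by rewrite adj_sym; apply: dist1 u3.
  have bvu : 0 < B u v by rewrite B_sym.
  have [s bs asv] := B_push1 e3u bvu.
  have b31' : 0 < B e3 a1 by rewrite B_sym.
  have b32' : 0 < B e3 a2 by rewrite B_sym.
  case: (B_three na12 b31' b32' bs) => es; rewrite es in asv.
    have avs : adj v a1 by rewrite adj_sym.
    have := dist_step diam h avs; rewrite !(dist_sym diam h); dlia.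
  have xv : x != v by apply/eqP => exv; rewrite -exv in vh; apply: xh; dlia.
  have a2x : adj a2 x by rewrite adj_sym.
  have ga2 : dist g a2 = 3.
    have := @low_high g x a1 a2 xa1 xa2 na12; rewrite (dist_adj diam ga1).
    have := adj_level (x := g) xa2; have := dist_step diam g xa2; dlia.
  have := @low_high g a2 x v a2x asv xv; dlia.
(* As before m is a repeat, now of a3, hence e1 or e2; then k, e3, y, m form a 4-cycle. *)
have [m um mk] : exists2 m, dist u m = 1 & dist m k = 1 by apply: dist_split; dlia.
have a3k : dist a3 k = D.-1.
  have a13 : dist a1 a3 = 2 := dist2 a1x xa3 na13.
  have := dist_triangle diam a3 a1 k; have := adj_level (x := a3) e3k.
  have := dist_step diam a3 e3k; dlia.
have akm : adj k m by rewrite adj_sym; apply: dist1 mk.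
have amk : adj m k by apply: dist1 mk.
have amu : adj m u by rewrite adj_sym; apply: dist1 um.
have m3 : e3 != m by apply: contra_neq nu3 => ->.
have a3m : dist a3 m = D.
  have := @low_high a3 k e3 m ak3 akm m3; have := adj_level (x := a3) akm.
  have := dist_le_diam diam a3 m; dlia.
have a3u : dist a3 u <= D.-1.
  have := dist_triangle diam w a3 u; rewrite (dist_sym diam a3 w) (dist_adj diam aw3).
  rewrite (dist_sym diam w u); dlia.
have uk' : u != k by apply: contra_eqN uk => /eqP ->; rewrite distxx.
have [_ bm] := @low_two a3 m u k amu amk uk' ltac:(dlia) ltac:(dlia).
have [ym m3'] : adj y m /\ m != e3.
  by case: (B_three n21 b32 b31 bm) => ->.
by case: (square_free ak3 e3y ym amk) => /eqP; apply/negP; rewrite // eq_sym.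
Qed.

(** * Counting short cycles *)

(* When B x y = 1, the vertices x and y are joined by exactly two geodesics,
   whose union is a cycle of length 2D. *)
Definition short_cycle x y := [set z | dist x z + dist z y == D].

(** A vertex of the cycle lies on the side of x' or on that of y', so its distances to the two ends
    change by opposite amounts. *)
Lemma short_cycle_sub x y x' y' : 0 < B x y -> adj x x' -> dist x' y = D.-1 ->
  adj y y' -> dist x y' = D.-1 -> dist x' y' <> D.-2 ->
  short_cycle x y \subset short_cycle x' y'.
Proof.
move=> b ax ex ay ey n; have eD := B_dist b.
have b' := antipode_step b ax ex ay ey n; have eD' := B_dist b'.
apply/subsetP => z; rewrite !inE => /eqP zS; apply/eqP.
have x'x : dist x' x = 1 by rewrite dist_sym dist_adj.
have yy' := dist_adj diam ay.
case: (posnP (dist x z)) => [/dist0 <-|xz]; first by dlia.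
case: (posnP (dist z y)) => [/dist0 ->|zy]; first by dlia.
have t1 := dist_triangle diam z x' y'.
case: (ltnP (dist x' z) (dist x z)) => [lt|ge].
  have := dist_triangle diam y z y'; dlia.
have zx' : dist z x' = (dist x z).+1.
  have := adj_level (x := z) ax; have := dist_step diam z ax.
  rewrite !(dist_sym diam z); dlia.
have [m am em] := @dist_pred _ _ diam z y (dist z y).-1 ltac:(dlia).
have xm : dist x m = D.-1.
  have := dist_triangle diam z x m; rewrite adj_sym in am.
  have := dist_step diam x am; dlia.
case: (eqVneq y' m) => [->|nm]; first by rewrite (dist_sym diam x'); dlia.
(* By [B_le1] only two neighbours of y are nearer to x, so m = p. Then x' and the neighbour x1 of x
   towards z are both nearer to m, hence equal, against [zx']. *)
have [p ap ep] := @dist_pred _ _ diam x' y D.-2 ltac:(dlia).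
have xp : dist x p = D.-1.
  have := dist_triangle diam x' x p; rewrite (dist_sym diam x x').
  have := dist_triangle diam p x y; rewrite (dist_sym diam p y) (dist_adj diam ap); dlia.
have mp : m = p.
  apply/eqP; apply: contraFT (ltnn 1) => mp.
  have py : p != y' by apply/eqP => epy; rewrite epy in ep.
  exact: leq_trans (three_low ay am ap ey xm xp nm mp py eD) (B_le1 x y).
have [x1 ax1 ex1] := @dist_pred _ _ diam z x (dist x z).-1 ltac:(rewrite dist_sym; dlia).
have : x' = x1.
  apply: (@low_uniq m x x' x1 ax ax1); rewrite !(dist_sym diam m) ?xm; try dlia.
    by rewrite mp; dlia.
  have := dist_triangle diam z x1 m; rewrite (dist_sym diam x1 z); dlia.
move=> e; rewrite -e in ex1; dlia.
Qed.

Lemma short_cycle_turn x y x' y' : 0 < B x y -> adj x x' -> dist x' y = D.-1 ->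
  adj y y' -> dist x y' = D.-1 -> dist x' y' <> D.-2 ->
  short_cycle x' y' = short_cycle x y.
Proof.
move=> b ax ex ay ey n; have b' := antipode_step b ax ex ay ey n.
apply/eqP; rewrite eqEsubset (short_cycle_sub b ax ex ay ey n) andbT.
apply: short_cycle_sub; rewrite // 1?adj_sym //; have := B_dist b; dlia.
Qed.

(** The pair of antipodes is turned towards z one step at a time. *)
Lemma short_cycle_antipode x y z : 0 < B x y -> z \in short_cycle x y ->
  exists2 y', 0 < B z y' & short_cycle z y' = short_cycle x y.
Proof.
move e : (dist x z) => i; elim: i x y e => [|i IH] x y e b zS.
  by rewrite -(dist0 e); exists y.
have [x1 xx1 x1z] : exists2 x1, dist x x1 = 1 & dist x1 z = i.
  by apply: dist_split; dlia.
have eD := B_dist b; have ax := dist1 xx1.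
have x1y : dist x1 y = D.-1.
  move: zS; rewrite inE => /eqP zS; have := dist_triangle diam z x1 y.
  have := dist_triangle diam x1 x y; dlia.
have [y1 [ay ey ny]] : exists y1, [/\ adj y y1, dist x y1 = D.-1 & dist x1 y1 <> D.-2].
  have [y1 [y2 [a1 a2 n12 e1 e2]]] := low_pair eD b.
  case: (eqVneq (dist x1 y1) D.-2) => [h1|/eqP h1]; last by exists y1.
  exists y2; split=> //; have := @low_high x1 y y1 y2 a1 a2 n12; dlia.
have tS := short_cycle_turn b ax x1y ay ey ny.
have b1 := antipode_step b ax x1y ay ey ny.
have [|y' by' Sy'] := IH x1 y1 x1z b1; first by rewrite tS.
by exists y'; rewrite // Sy'.
Qed.

Lemma short_cycle_inj x y y' : 0 < B x y -> 0 < B x y' ->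
  short_cycle x y = short_cycle x y' -> y = y'.
Proof.
move=> /B_dist e /B_dist e' /setP/(_ y'); rewrite !inE distxx addn0 e' eqxx.
by move=> /eqP h; apply/esym/(dist0 (diam := diam)); dlia.
Qed.

Definition layer x y i := [set z | (dist x z == i) && (dist z y == D - i)].

Lemma layer_sym x y i : i <= D -> layer x y i = layer y x (D - i).
Proof.
move=> iD; apply/setP => z; rewrite !inE andbC subKn //.
by rewrite (dist_sym diam z y) (dist_sym diam x z).
Qed.

(** Stepping towards y is injective, as predecessors below distance D are unique; the default in [f]
    is never reached on the layer. *)
Lemma layer_le x y i : dist x y = D -> 0 < i -> i.+1 < D ->
  #|layer x y i| <= #|layer x y i.+1|.
Proof.
move=> eD i0 iD.
pose f z := odflt z [pick t | adj z t && (dist t y == D - i.+1)].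
have fP z : z \in layer x y i -> adj z (f z) /\ f z \in layer x y i.+1.
  rewrite inE => /andP[/eqP xz /eqP zy]; rewrite /f; case: pickP => [t|no] /=.
    move=> /andP[a /eqP ty]; split=> //; rewrite inE ty eqxx andbT; apply/eqP.
    have := dist_step diam x a; have := dist_triangle diam t x y; dlia.
  have [t zt ty] : exists2 t, dist z t = 1 & dist t y = D - i.+1.
    by apply: dist_split; dlia.
  by have := no t; rewrite (dist1 zt) ty eqxx.
rewrite -(@card_in_imset _ _ f) => [|z1 z2 h1 h2 e].
  by apply/subset_leq_card/subsetP => _ /imsetP[z /fP[_ h] ->].
have [a1 l1] := fP z1 h1; have [a2 _] := fP z2 h2; rewrite -e in a2.
move: h1 h2 l1; rewrite !inE => /andP[/eqP e1 _] /andP[/eqP e2 _] /andP[/eqP e3 _].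
by apply: (@low_uniq x (f z1)); rewrite 1?adj_sym // e3 ?e1 ?e2; dlia.
Qed.

(** Read from both ends, [layer_le] makes the layer sizes constant, and layer D - 1 has size
    [E x y], which is [B x y + 1]. *)
Lemma card_layer x y i : 0 < B x y -> 0 < i < D -> #|layer x y i| = 2.
Proof.
move=> b /andP[i0 iD]; have eD := B_dist b.
have eD' : dist y x = D by rewrite dist_sym.
have step j : 0 < j -> j.+1 < D -> #|layer x y j| = #|layer x y j.+1|.
  move=> j0 jD; apply/eqP; rewrite eqn_leq layer_le //=.
  rewrite (layer_sym x y (ltnW jD)) (layer_sym x y (ltnW (ltnW jD))).
  have -> : D - j = (D - j.+1).+1 by dlia.
  by apply: layer_le; dlia.
have last_layer : #|layer x y D.-1| = 2.
  have <- : E x y = 2.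
    have := B_le1 x y; move: b; rewrite /B eD eqxx; lia.
  rewrite E_card; apply: eq_card => z; rewrite !inE andbC; congr (_ && _).
  rewrite adj_sym (_ : D - D.-1 = 1); last dlia.
  by apply/eqP/idP => [/dist1|/dist_adj].
have down k : k < D.-1 -> #|layer x y (D.-1 - k)| = 2.
  elim: k => [|k IH] kD; first by rewrite subn0.
  rewrite step; try dlia.
  by rewrite -[X in layer _ _ X](_ : D.-1 - k = _) ?IH; dlia.
have -> : i = D.-1 - (D.-1 - i) by dlia.
by apply: down; dlia.
Qed.

Lemma card_short_cycle x y : 0 < B x y -> #|short_cycle x y| = 2 * D.
Proof.
move=> b; have eD := B_dist b.
have -> : #|short_cycle x y| = \sum_(i < D.+1) #|layer x y i|.
  rewrite -sum1_card (partition_big (fun z => inord (dist x z) : 'I_D.+1) predT) //=.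
  apply: eq_bigr => i _; rewrite -sum1_card; apply: eq_bigl => z.
  rewrite !inE -val_eqE /= inordK ?ltnS ?dist_le_diam // andbC.
  case: eqP => //= ->; have := ltn_ord i; dlia.
have l0 : layer x y 0 = [set x].
  apply/setP => z; rewrite !inE subn0; apply/andP/eqP => [[/eqP/dist0 //]|->].
  by rewrite distxx eD !eqxx.
have lD : layer x y D = [set y].
  apply/setP => z; rewrite !inE subnn; apply/andP/eqP => [[_ /eqP/dist0 //]|->].
  by rewrite distxx eD !eqxx.
rewrite big_ord_recr /= lD cards1 -(big_mkord xpredT (fun i => #|layer x y i|)).
rewrite big_ltn; last by dlia.
rewrite l0 cards1 (eq_big_nat _ _ (F2 := fun=> 2)); last first.
  by move=> i hi; apply: card_layer.
rewrite sum_nat_const_nat; dlia.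
Qed.

(** The ordered pairs of repeats number twice the order by the row sums of B, and 2D for each short
    cycle. *)
Lemma diam_dvd_order : D %| #|G|.
Proof.
pose pairs := [set p : G * G | 0 < B p.1 p.2].
pose cyc (p : G * G) := short_cycle p.1 p.2.
have e1 : #|pairs| = 2 * #|G|.
  rewrite -sum1dep_card.
  transitivity (\sum_(p : G * G) B p.1 p.2).
    rewrite big_mkcond; apply: eq_bigr => p _.
    by have := B_le1 p.1 p.2; case: (B _ _) => [|[]].
  rewrite -(pair_bigA _ B) /= (eq_bigr (fun=> 2)) => [|x _]; last exact: sumB.
  by rewrite sum_nat_const mulnC; congr (_ * _); apply: eq_card.
have e2 : #|pairs| = #|cyc @: pairs| * (2 * D).
  (* The first projection maps the pairs that span a cycle T bijectively onto the vertices of T. *)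
  rewrite -sum1_card (partition_big_imset cyc) /= -sum_nat_const.
  apply: eq_bigr => T /imsetP[[x y]]; rewrite inE /= => b ->.
  rewrite -(card_short_cycle b) sum1dep_card.
  rewrite -(@card_in_imset _ _ fst) => [|[u v] [u' v']]; last first.
    rewrite !inE /cyc /= => /andP[b1 /eqP c1] /andP[b2 /eqP c2] e.
    rewrite -e in b2 c2 *; congr pair; apply: (short_cycle_inj b1 b2).
    by rewrite c1 c2.
  apply: eq_card => z; apply/imsetP/idP => [[[u v] uv ->]|].
    rewrite !inE /cyc /= in uv; case/andP: uv => b1 /eqP <-; rewrite inE distxx.
    by rewrite (B_dist b1) eqxx.
  move=> /(short_cycle_antipode b)[v bv cv]; exists (z, v) => //.
  by rewrite !inE /cyc /= bv cv eqxx.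
apply/dvdnP; exists #|cyc @: pairs|; lia.
Qed.

End MooreTree.

Theorem theorem5p9 (d D n : nat) (hd : 5 <= d) (hodd : odd d) (hD : 4 <= D)
  (hn : n = d * (\sum_(0 <= i < D) (d - 1) ^ i) - 1)
  (hmod : n <> 0 %[mod D]) :
  ~ exists G : sgraph, defect_graph d D 2 G.
Proof.
case=> G [maxd [diam _] order]; apply: hmod.
have deg (x : G) : degree x <= d by rewrite -maxd /max_degree leq_bigmax.
have : D %| #|G| by apply: diam_dvd_order deg order _ _ => //; apply: ltnW.
rewrite /moore_bound in order.
have -> : #|G| = n by lia.
by rewrite mod0n => /eqP.
Qed.
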